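(* The game zero forcing number is not nondecreasing under edge subdivision: there exist a connected graph $G$ with at least one edge and an edge $e$ of $G$ such that the graph $G'$ obtained from $G$ by subdividing $e$ satisfies $Z_g(G')<Z_g(G)$.
   Context: All graphs are finite and simple. Subdividing an edge $e=xy$ means deleting $e$, adding one new vertex $w$, and adding the edges $xw$ and $wy$. The game: Let $G$ be a connected graph with at least one edge; initially all vertices are white. Alice (blue) and Bob (red) alternate turns, Alice first. On each turn the player makes exactly one move: a seed move (colour one white vertex with the player's colour) or a force move $u\to v$ (if a vertex $u$ of the player's colour has exactly one white neighbour $v$, colour $v$ with the player's colour). Being the unique white neighbour is with respect to all white vertices, irrespective of who coloured the others. If a white vertex is the target of one of the player's own legal forces, colouring it counts as a force move and not as a seed move. A move blocks a legal force $u\to v$ if that force is no longer legal after the move. Force Preservation Rule: considering the opponent's legal forces (those the opponent's coloured vertices could make) at the beginning of a turn, (i) a player may always perform one of their own legal forces, even if this blocks a force of the opponent; (ii) a seed move that blocks a legal force of the opponent is permitted only when every available seed move blocks at least one of the opponent's legal forces. The game ends when every vertex is coloured. Optimal play and $Z_g$: For a position $P$ define a set $\mathcal O(P)$ of pairs. If $P$ is terminal and Alice and Bob made $s_A$ and $s_B$ seed moves in total, then $\mathcal O(P)=\{(s_A,s_B)\}$. Otherwise let $\mathcal U(P)=\bigcup_m \mathcal O(P_m)$ over all legal moves $m$, where $P_m$ is the resulting position; $\mathcal O(P)$ is the set of all pairs in $\mathcal U(P)$ with minimum first coordinate if Alice is to move, and with minimum second coordinate if Bob is to move. Let $\mathcal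 O(G)=\mathcal O(P_0(G))$ for the initial position $P_0(G)$. The game zero forcing number is $Z_g(G)=\min\{s_A+s_B:(s_A,s_B)\in\mathcal O(G)\}$. *)

(* Defs.v *)
From HB Require Import structures.
From mathcomp Require Import all_boot.

Set Implicit Arguments.
Unset Strict Implicit.
Unset Printing Implicit Defensive.

Record sgraph := SGraph {
  vertex :> finType;
  adj : rel vertex;
  adj_sym : symmetric adj;
  adj_irrefl : irreflexive adj }.

Definition connected (G : sgraph) : Prop :=
  0 < #|G| /\ forall x y : G, connect (@adj G) x y.

(* [Some a] is the old vertex a and [None] is the subdividing vertex w. *)
Definition subdivide_adj (G : sgraph) (x y : G) : rel (option G) :=
  fun a b => match a, b with
  | Some u, Some v =>
      adj u v && ~~ ((u == x) && (v == y) || (u == y) && (v == x))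
  | Some u, None | None, Some u => (u == x) || (u == y)
  | None, None => false
  end.

Lemma subdivide_adj_sym (G : sgraph) (x y : G) : symmetric (subdivide_adj x y).
Proof.
move=> [u|] [v|] //=; rewrite adj_sym; congr (_ && ~~ _).
by rewrite orbC andbC [in X in _ || X]andbC.
Qed.

Lemma subdivide_adj_irrefl (G : sgraph) (x y : G) :
  irreflexive (subdivide_adj x y).
Proof. by move=> [u|] //=; rewrite adj_irrefl. Qed.

Definition subdivide (G : sgraph) (x y : G) : sgraph :=
  SGraph (subdivide_adj_sym x y) (subdivide_adj_irrefl x y).

Inductive player := Alice | Bob.

Definition bool_of_player p := if p is Alice then true else false.
Definition player_of_bool b := if b then Alice else Bob.
Lemma bool_of_playerK : cancel bool_of_player player_of_bool.
Proof. by case. Qed.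
HB.instance Definition _ := Equality.copy player (can_type bool_of_playerK).

Definition opponent p := if p is Alice then Bob else Alice.

(* [None] means white. *)
Definition coloring (G : sgraph) := {ffun G -> option player}.

Definition paint (G : sgraph) (c : coloring G) (v : G) (p : player) :
  coloring G := [ffun w => if w == v then Some p else c w].

Definition white_nbrs (G : sgraph) (c : coloring G) (u : G) : {set G} :=
  [set w | adj u w & c w == None].

Definition can_force (G : sgraph) (c : coloring G) (p : player) (u v : G) :
  bool := (c u == Some p) && (white_nbrs c u == [set v]).

(* Colouring the target of an own legal force is never a seed move. *)
Definition available_seed (G : sgraph) (c : coloring G) (p : player) (v : G) :
  bool := (c v == None) && ~~ [exists u, can_force c p u v].

Definition blocks (G : sgraph) (c : coloring G) (p : player) (v : G) : bool :=
  [exists u, exists w, can_force c (opponent p) u w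
                    && ~~ can_force (paint c v p) (opponent p) u w].

Definition legal_seed (G : sgraph) (c : coloring G) (p : player) (v : G) :
  bool :=
  available_seed c p v
  && (blocks c p v ==> [forall w, available_seed c p w ==> blocks c p w]).

Inductive move (G : sgraph) := Seed of G | Force of G & G.

Definition sum_of_move (G : sgraph) (m : move G) : G + G * G :=
  match m with Seed v => inl v | Force u v => inr (u, v) end.
Definition move_of_sum (G : sgraph) (s : G + G * G) : move G :=
  match s with inl v => Seed v | inr (u, v) => Force u v end.
Lemma sum_of_moveK (G : sgraph) : cancel (@sum_of_move G) (@move_of_sum G).
Proof. by case. Qed.
HB.instance Definition _ (G : sgraph) :=
  Finite.copy (move G) (can_type (@sum_of_moveK G)).

(* [seeds] is the pair (s_A, s_B) of numbers of seed moves made so far. *)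
Record position (G : sgraph) := Position {
  colors : coloring G;
  turn : player;
  seeds : nat * nat }.

Definition initial_position (G : sgraph) : position G :=
  Position [ffun=> None] Alice (0, 0).

Definition terminal (G : sgraph) (P : position G) : bool :=
  [forall v, colors P v != None].

Definition legal (G : sgraph) (P : position G) (m : move G) : bool :=
  match m with
  | Seed v => legal_seed (colors P) (turn P) v
  | Force u v => can_force (colors P) (turn P) u v
  end.

Definition legal_moves (G : sgraph) (P : position G) : seq (move G) :=
  [seq m <- enum {: move G} | legal P m].

Definition add_seed (p : player) (s : nat * nat) : nat * nat :=
  if p is Alice then (s.1.+1, s.2) else (s.1, s.2.+1).

Definition play (G : sgraph) (P : position G) (m : move G) : position G :=
  let p := turn P in
  match m with
  | Seed v => Position (paint (colors P) v p) (opponent p) (add_seed p (seeds P))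
  | Force _ v => Position (paint (colors P) v p) (opponent p) (seeds P)
  end.

Definition cost (p : player) (s : nat * nat) : nat :=
  if p is Alice then s.1 else s.2.

Definition best (p : player) (U : seq (nat * nat)) : seq (nat * nat) :=
  [seq s <- U | all (fun t => cost p s <= cost p t) U].

Definition white (G : sgraph) (P : position G) : {set G} :=
  [set v | colors P v == None].

(* Finite sets of pairs are represented by sequences, up to order and
   multiplicity. The fuel n bounds the number of remaining moves; with
   n = #|white P| it is never exhausted, cf. [outcomesE]. *)
Fixpoint outcomes_rec (G : sgraph) (n : nat) (P : position G) :
  seq (nat * nat) :=
  if terminal P then [:: seeds P] else
  if n is n'.+1 then
    best (turn P) (flatten [seq outcomes_rec n' (play P m) | m <- legal_moves P])
  else [::].

Definition outcomes (G : sgraph) (P : position G) : seq (nat * nat) :=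
  outcomes_rec #|white P| P.

Lemma mem_legal_moves (G : sgraph) (P : position G) m :
  (m \in legal_moves P) = legal P m.
Proof. by rewrite mem_filter mem_enum andbT. Qed.

Lemma white_play (G : sgraph) (P : position G) m :
  legal P m -> #|white P| = #|white (play P m)|.+1.
Proof.
pose w := match m with Seed v | Force _ v => v end.
move=> Lm; have Ww: w \in white P.
  rewrite inE; case: m @w Lm => [v|u v] /= => [/andP[/andP[] //]|].
  by case/andP=> _ /eqP/setP/(_ v); rewrite !inE eqxx => /andP[].
rewrite (cardsD1 w) Ww add1n; congr _.+1; apply: eq_card => v.
rewrite !inE; case: m @w {Lm Ww} => [x|u x] /=; rewrite ffunE;
  by case: (v == x).
Qed.

Lemma outcomesE (G : sgraph) (P : position G) :
  outcomes P =
    if terminal P then [:: seeds P]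
    else best (turn P) (flatten [seq outcomes (play P m) | m <- legal_moves P]).
Proof.
rewrite /outcomes; case E: #|white P| => [|n] /=; case: ifPn => // T.
  case/forallPn: T => v; rewrite negbK => cv.
  by move/eqP: E; rewrite cards_eq0 => /eqP/setP/(_ v); rewrite !inE cv.
congr (best _ (flatten _)); apply/eq_in_map => m; rewrite mem_legal_moves.
by move/white_play; rewrite E => -[->].
Qed.

Lemma legal_moves_neq0 (G : sgraph) (P : position G) :
  ~~ terminal P -> exists m, m \in legal_moves P.
Proof.
case/forallPn=> v; rewrite negbK => cv.
case: (boolP [exists u, exists w, can_force (colors P) (turn P) u w]).
  by case/existsP=> u /existsP[w F]; exists (Force u w); rewrite mem_legal_moves.
rewrite negb_exists => /forallP NF.
have Av w: colors P w == None -> available_seed (colors P) (turn P) w.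
  move=> cw; rewrite /available_seed cw negb_exists; apply/forallP=> u.
  by have:= NF u; rewrite negb_exists => /forallP.
case: (boolP [forall w, available_seed (colors P) (turn P) w
                        ==> blocks (colors P) (turn P) w]) => [B|].
  exists (Seed v); rewrite mem_legal_moves /= /legal_seed Av //=.
  by rewrite B implybT.
case/forallPn=> w; rewrite negb_imply => /andP[Aw Bw].
by exists (Seed w); rewrite mem_legal_moves /= /legal_seed Aw (negPf Bw).
Qed.

Lemma best_neq0 p (U : seq (nat * nat)) s :
  s \in U -> exists t, t \in best p U.
Proof.
move=> sU.
have ex: exists n, n \in [seq cost p t | t <- U].
  by exists (cost p s); apply: map_f.
case: (ex_minnP ex) => _ /mapP[t tU ->] tmin; exists t.
by rewrite mem_filter tU andbT; apply/allP=> r rU; apply/tmin/map_f.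
Qed.

Lemma outcomes_neq0 (G : sgraph) (P : position G) :
  exists s, s \in outcomes P.
Proof.
have [n] := ubnP #|white P|; elim: n P => // n IH P; rewrite ltnS => Pn.
rewrite outcomesE; case: ifPn => [_|/legal_moves_neq0[m Lm]].
  by exists (seeds P); rewrite mem_head.
case: (IH (play P m)).
  by move: Lm; rewrite mem_legal_moves => /white_play E; rewrite -E.
move=> s sm; apply: (@best_neq0 _ _ s); apply/flatten_mapP; by exists m.
Qed.

Lemma Zg_subproof (G : sgraph) :
  exists k, k \in [seq s.1 + s.2 | s <- outcomes (initial_position G)].
Proof.
case: (outcomes_neq0 (initial_position G)) => s sO.
by exists (s.1 + s.2); apply/mapP; exists s.
Qed.

Definition Zg (G : sgraph) : nat := ex_minn (Zg_subproof G).

(* Main.v *)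
Require Import Defs.
From mathcomp Require Import all_boot.

Set Implicit Arguments.
Unset Strict Implicit.
Unset Printing Implicit Defensive.

(** The claw [K_{1,3}] is a witness. There every optimal play has seed counts
    (1, 2), whereas in the claw with one edge subdivided they are (1, 1). Both
    games are small enough to be solved by evaluating the whole game tree. *)

(** The source of a force is already coloured and its target is its only white neighbour, so
    colouring any other white vertex leaves the force intact. This reduces the Force Preservation
    Rule to a test on targets. *)
Lemma blocksE (G : sgraph) (c : coloring G) (p : player) (v : G) :
  c v = None -> blocks c p v = [exists u, can_force c (opponent p) u v].
Proof.
move=> cv; apply/existsP/existsP => -[u].
  case/existsP=> w /andP[/[dup] Fuw /andP[cu /eqP Wu]].
  rewrite negb_and; have uv : u != v.
    by apply: contraTneq cu => ->; rewrite cv.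
  rewrite ffunE (negPf uv) cu /= => Wu'.
  suff -> : v = w by exists u; move: Fuw.
  apply: contraNeq Wu' => vw; rewrite -Wu; apply/eqP/setP => x.
  rewrite !inE ffunE; case: (eqVneq x v) => // ->.
  by move/setP/(_ v): Wu; rewrite !inE cv eqxx (negPf vw) andbT => ->.
move=> Fuv; exists u; apply/existsP; exists v; rewrite Fuv /= negb_and.
apply/orP; right; apply/eqP => /setP/(_ v).
by rewrite !inE ffunE eqxx andbF.
Qed.

(* An executable copy of [outcomes_rec]: colourings are plain functions and the
   quantifiers range over an explicit list [vs] of all vertices, because finite
   functions and [[forall x, _]] are locked. A branch is a vertex to colour,
   since different forces with the same target lead to the same position. *)
Section Evaluation.

Variables (G : sgraph) (vs : seq G).
Implicit Types (c : G -> option player) (p : player) (s : nat * nat).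

Definition forces_into c p (v : G) : bool :=
  has (fun u => [&& c u == Some p, adj u v, c v == None &
                 all (fun w => adj u w ==> (c w == None) ==> (w == v)) vs]) vs.

Definition seedable c p (v : G) : bool :=
  (c v == None) && ~~ forces_into c p v.

Definition seed_allowed c p (v : G) : bool :=
  seedable c p v &&
  (forces_into c (opponent p) v ==>
   all (fun w => seedable c p w ==> forces_into c (opponent p) w) vs).

Fixpoint eval_outcomes n c p s : seq (nat * nat) :=
  if all (fun v => c v != None) vs then [:: s] else
  if n is n'.+1 then
    best p (flatten [seq
      let c' := fun w => if w == v then Some p else c w in
      if forces_into c p v then eval_outcomes n' c' (opponent p) s
      else if seed_allowed c p v
      then eval_outcomes n' c' (opponent p) (add_seed p s) else [::] | v <- vs])
  else [::].

Hypothesis vsT : forall v, v \in vs.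

Lemma all_forall (a : pred G) : all a vs = [forall v, a v].
Proof. by apply/allP/forallP => [a_vs v|a_T v _]; [apply: a_vs|apply: a_T]. Qed.

Lemma has_exists (a : pred G) : has a vs = [exists v, a v].
Proof.
by apply/hasP/existsP => [[v _ av]|[v av]]; exists v => //; apply: vsT.
Qed.

Variables (cc : coloring G) (c : G -> option player).
Hypothesis cE : cc =1 c.

Lemma forces_intoE p v :
  forces_into c p v = [exists u, can_force cc p u v].
Proof.
rewrite /forces_into has_exists; apply: eq_existsb => u; rewrite /can_force cE.
case: (c u == _) => //=; apply/and3P/eqP => [[uv cv /allP Wu]|Wu].
  apply/setP => w; rewrite !inE cE; apply/andP/eqP => [[uw cw]|->//].
  by apply/eqP; move: (Wu w (vsT w)); rewrite uw cw.
have /setP/(_ v) := Wu; rewrite !inE eqxx cE => /andP[uv cv]; split=> //.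
apply/allP => w _; apply/implyP => uw; apply/implyP => cw.
by move/setP/(_ w): Wu; rewrite !inE cE uw cw => <-.
Qed.

Lemma seedableE p v : seedable c p v = available_seed cc p v.
Proof. by rewrite /seedable forces_intoE /available_seed cE. Qed.

(** Blocking agrees with being the target of an opposing force at white vertices; the rule consults
    it only at available seeds, which are white. *)
Lemma seed_allowedE p v : seed_allowed c p v = legal_seed cc p v.
Proof.
have bE w : available_seed cc p w ->
    blocks cc p w = forces_into c (opponent p) w.
  by case/andP=> /eqP cw _; rewrite blocksE // forces_intoE.
rewrite /seed_allowed /legal_seed seedableE.
case: (boolP (available_seed _ _ v)) => //= Av; rewrite bE // all_forall.
congr (_ ==> _); apply: eq_forallb => w; rewrite seedableE.
by case: (boolP (available_seed _ _ w)) => //= Aw; rewrite bE.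
Qed.

End Evaluation.

Lemma eq_mem_best (p : player) (U V : seq (nat * nat)) :
  U =i V -> best p U =i best p V.
Proof. by move=> UV s; rewrite !mem_filter UV (eq_all_r UV). Qed.

(** The two sides agree as sets only: [legal_moves] lists a force once per source, while the
    evaluator merges forces with the same target. *)
Lemma eval_outcomesE (G : sgraph) (vs : seq G) n (P : position G) c :
    (forall v, v \in vs) -> colors P =1 c ->
  outcomes_rec n P =i eval_outcomes vs n c (turn P) (seeds P).
Proof.
move=> vsT; elim: n P c => [|n IH] P c cE /=.
all: have -> : terminal P = all (fun v => c v != None) vs
  by rewrite (all_forall vsT); apply: eq_forallb => v; rewrite cE.
all: case: ifP => // _.
(* Seeds and forces lead to positions of the same shape, differing only in the seed pair [s], so one
   use of the induction hypothesis serves both. *)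
have playE v s : outcomes_rec n
      (Position (paint (colors P) v (turn P)) (opponent (turn P)) s)
    =i eval_outcomes vs n (fun w => if w == v then Some (turn P) else c w)
         (opponent (turn P)) s.
  by apply: IH => w; rewrite ffunE cE.
apply: eq_mem_best => s; apply/flatten_mapP/flatten_mapP => -[].
  case=> [v|u v]; rewrite mem_legal_moves /= => Lm sm; exists v => //.
    have:= Lm; rewrite -(seed_allowedE vsT cE) => Lv; rewrite Lv.
    case/andP: (Lv) => /andP[_ /negPf->] _.
    by rewrite playE in sm.
  rewrite (forces_intoE vsT cE); case: existsP => [_|[]]; last by exists u.
  by rewrite playE in sm.
move=> v _; case: ifP => [|_].
  rewrite (forces_intoE vsT cE) => /existsP[u Fuv] sv.
  exists (Force u v); first by rewrite mem_legal_moves.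
  by rewrite playE.
case: ifP => // Lv sv; exists (Seed v).
  by rewrite mem_legal_moves /= -(seed_allowedE vsT cE).
by rewrite playE.
Qed.

(** The minimum defining [Zg] is attained by some outcome, which the evaluation identifies as
    [s]. *)
Lemma Zg_eval (G : sgraph) (vs : seq G) (s : nat * nat) :
    (forall v, v \in vs) ->
    all (pred1 s) (eval_outcomes vs #|G| (fun=> None) Alice (0, 0)) ->
  Zg G = s.1 + s.2.
Proof.
move=> vsT /allP s_eval; rewrite /Zg; case: ex_minnP => k /mapP[t tO ->] _.
suff /eqP-> : t == s by [].
apply: s_eval; move: tO; rewrite /outcomes.
(* Every vertex is white at the start, so the fuel is the order of the graph. *)
have -> : #|white (initial_position G)| = #|G|.
  by apply: eq_card => v; rewrite !inE ffunE eqxx.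
by rewrite (eval_outcomesE _ (c := fun=> None) vsT) // => v; rewrite ffunE.
Qed.

(** The centre is [ord0]; with exclusive or, symmetry and irreflexivity are laws of addition modulo
    2. *)
Definition claw_adj : rel 'I_4 := fun i j => (i == ord0) (+) (j == ord0).

Lemma claw_adj_sym : symmetric claw_adj.
Proof. by move=> i j; apply: addbC. Qed.

Lemma claw_adj_irrefl : irreflexive claw_adj.
Proof. by move=> i; apply: addbb. Qed.

Definition claw : sgraph := SGraph claw_adj_sym claw_adj_irrefl.

Definition claw_vertices : seq claw :=
  [:: ord0; @Ordinal 4 1 isT; @Ordinal 4 2 isT; @Ordinal 4 3 isT].

Lemma mem_claw_vertices v : v \in claw_vertices.
Proof. by case: v => -[|[|[|[|]]]]. Qed.

Lemma claw_connected : connected claw.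
Proof.
split=> [|x y]; first by rewrite card_ord.
have c0 z : connect claw_adj ord0 z.
  case: (eqVneq z ord0) => [->|z0]; first exact: connect0.
  by apply: connect1; rewrite /claw_adj eqxx (negPf z0).
apply: connect_trans (c0 y).
by rewrite (sym_connect_sym claw_adj_sym) c0.
Qed.

(** Optimal play: Alice seeds a leaf; Bob may not block her force onto the centre and seeds a second
    leaf; Alice forces the centre; Bob has to seed the last leaf. *)
Lemma Zg_claw : Zg claw = 3.
Proof.
rewrite (@Zg_eval _ claw_vertices (1, 2)) //; first exact: mem_claw_vertices.
by rewrite card_ord; vm_compute.
Qed.

(** An optimal line: Alice seeds a leaf next to the centre and Bob the leaf [Some ord_max]; then
    Alice forces the centre, Bob forces [None], and Alice forces the last leaf from the centre. *)
Lemma Zg_subdivided_claw : Zg (@subdivide claw ord0 ord_max) = 2.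
Proof.
pose G := @subdivide claw ord0 ord_max.
rewrite (@Zg_eval G (None :: map Some claw_vertices) (1, 1)) //.
  by case=> // v; rewrite inE; apply/orP; right; apply/map_f/mem_claw_vertices.
by rewrite card_option card_ord; vm_compute.
Qed.

Theorem proposition24 :
  exists (G : sgraph) (x y : G),
    [/\ connected G, adj x y & Zg (subdivide x y) < Zg G].
Proof.
exists claw, ord0, ord_max; split=> //; first exact: claw_connected.
by rewrite Zg_claw Zg_subdivided_claw.
Qed.
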